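(* Suppose that $K:T(E)\to E$ is a vertical connection on a differential bundle $\mathsf{q}=(q:E\to M,+_q,0_q,\lambda)$ over $M$ in a tangent category. Let $f:X\to M$ be a map for which the pullback bundle $f^*(\mathsf{q})$ exists as a differential bundle, with pullback projections $f^*(q):f^*(E)\to X$ and $f^*_E:f^*(E)\to E$. Then $f^*(K):T(f^*(E))\to f^*(E)$, the unique map with $f^*(K)f^*_E=T(f^*_E)K$ and $f^*(K)f^*(q)=T(f^*(q))p_X$, is a vertical connection on $f^*(\mathsf{q})$.
   Context: Conventions: composites are written in diagrammatic order ($fg$ means first $f$, then $g$). $\langle f,g\rangle$ is the induced map into a pullback, $\pi_0,\pi_1$ are projections. Component subscripts of natural transformations are often omitted. An additive bundle over $M$ is a map $q:E\to M$ whose finite wide pullbacks $E_n$ along itself exist, with maps $+_q:E_2\to E$, $0_q:M\to E$ making $q$ a commutative monoid in the slice over $M$. An additive bundle morphism $(f_1,f_0)$ from $q:E\to M$ to $q':E'\to M'$ is a pair $f_1:E\to E'$, $f_0:M\to M'$ with $f_1q'=qf_0$ preserving addition and zero. A tangent category is a category with a functor $T$ and natural transformations $p:T\to 1$, $0:1\to T$, $+:T_2\to T$, $\ell:T\to T^2$, $c:T^2\to T^2$ such that: each $(p_M,+_M,0_M)$ is an additive bundle, the wide pullbacks $T_nM$ of $p_M$ exist and are preserved by each $T^k$; $(\ell_M,0_M)$ is an additive bundle morphism from $(p_M,+_M,0_M)$ to $(T(p_M),T(+_M),T(0_M))$; $(c_M,1)$ is an additive bundle morphism from $(T(p_M),T(+_M),T(0_M))$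 to $(p_{TM},+_{TM},0_{TM})$; $c^2=1$, $\ell c=\ell$, $\ell_M\ell_{TM}=\ell_MT(\ell_M)$, $T(c)cT(c)=cT(c)c$, $\ell_{TM}T(c_M)c_{TM}=c_MT(\ell_M)$; and the square with top $\langle\pi_0\ell,\pi_10\rangle T(+):T_2M\to T^2M$, left $\pi_0p=\pi_1p$, right $T(p)$, bottom $0_M$ is a pullback preserved by each $T^k$. A differential bundle $\mathsf{q}=(q:E\to M,+_q,0_q,\lambda)$ is an additive bundle with a lift $\lambda:E\to T(E)$ such that: the wide pullbacks $E_n$ are preserved by each $T^k$; for all $n,m$ the pullback of $E_n\to M$ along $T_mM\to M$ exists and is preserved by each $T^k$; $(\lambda,0_M)$ is an additive bundle morphism from $q$ to $(T(q),T(+_q),T(0_q))$; $(\lambda,0_q)$ is an additive bundle morphism from $q$ to $(p_E,+_E,0_E)$; with $\mu:=\langle\pi_0\lambda,\pi_10\rangle T(+_q):E_2\to T(E)$, the square with top $\mu$, left $\pi_0q=\pi_1q:E_2\to M$, right $T(q)$, bottom $0_M$ is a pullback (preserved by each $T^k$); and $\lambda\ell_E=\lambda T(\lambda)$. Pullback bundle: for $f:X\to M$, if the pullback $f^*(E)$ of $q$ along $f$ exists and is preserved by each $T^k$, and the further pullbacks required by the definition of differential bundle exist and are preserved, then $f^*(\mathsf{q})$ is $f^*(q):f^*(E)\to X$ with induced addition and zero and lift $f^*(\lambda)$, the unique map $f^*(E)\to T(f^*(E))$ with $f^*(\lambda)T(f^*_E)=f^*_E\lambda$ and $f^*(\lambda)T(f^*(q))=f^*(q)0_X$;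 it is a differential bundle. A vertical connection on a differential bundle $\mathsf{q}$ is a map $K:T(E)\to E$ with $\lambda K=1_E$, $Kq=pq$, $K\lambda=\ell_ET(K)$ and $K\lambda=T(\lambda)c_ET(K)$. *)

(* Defs.v *)
From mathcomp Require Import all_boot.
From Stdlib Require Import ClassicalEpsilon.

Set Implicit Arguments.
Unset Strict Implicit.
Unset Printing Implicit Defensive.

(** * Categories and functors *)

Declare Scope cat_scope.
Delimit Scope cat_scope with cat.
Local Open Scope cat_scope.

Reserved Notation "f ;; g" (at level 50, left associativity).

(* [f ;; g] is the composite in diagrammatic order: first [f], then [g]. *)
Record category := Category {
  ob :> Type;
  hom : ob -> ob -> Type;
  idm : forall A, hom A A;
  comp : forall A B D, hom A B -> hom B D -> hom A D
    where "f ;; g" := (comp f g);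
  comp1m : forall A B (f : hom A B), idm A ;; f = f;
  compm1 : forall A B (f : hom A B), f ;; idm B = f;
  compA : forall A B D F (f : hom A B) (g : hom B D) (h : hom D F),
    f ;; (g ;; h) = f ;; g ;; h
}.
Arguments hom {_} _ _.
Arguments idm {_} _.
Arguments comp {_ _ _ _} _ _.
Notation "f ;; g" := (comp f g) : cat_scope.

Record functor (C D : category) := Functor {
  fob :> C -> D;
  fmap : forall A B, hom A B -> hom (fob A) (fob B);
  fmap1 : forall A, fmap (idm A) = idm (fob A);
  fmapM : forall A B F (f : hom A B) (g : hom B F),
    fmap (f ;; g) = fmap f ;; fmap g
}.
Arguments fmap {_ _} _ {_ _} _.

Definition fid (C : category) : functor C C :=
  @Functor C C id (fun _ _ f => f) (fun _ => erefl) (fun _ _ _ _ _ => erefl).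

Section Composition.
Variables (C D F : category) (G : functor C D) (H : functor D F).

Lemma fcomp1 A : fmap H (fmap G (idm A)) = idm (H (G A)).
Proof. by rewrite !fmap1. Qed.

Lemma fcompM A B B' (f : hom A B) (g : hom B B') :
  fmap H (fmap G (f ;; g)) = fmap H (fmap G f) ;; fmap H (fmap G g).
Proof. by rewrite !fmapM. Qed.

Definition fcomp : functor C F :=
  @Functor C F (fun A => H (G A)) (fun _ _ f => fmap H (fmap G f))
    fcomp1 fcompM.
End Composition.

Fixpoint fpow (C : category) (T : functor C C) (k : nat) : functor C C :=
  if k is j.+1 then fcomp (fpow T j) T else fid C.

Definition natural (C D : category) (F G : functor C D)
    (a : forall A, hom (F A) (G A)) : Prop :=
  forall A B (f : hom A B), a A ;; fmap G f = fmap F f ;; a B.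

(** * Pullbacks and finite wide pullbacks *)

Definition is_pullback (C : category) (A B D P : C)
    (f : hom A D) (g : hom B D) (pA : hom P A) (pB : hom P B) : Prop :=
  pA ;; f = pB ;; g /\
  forall (X : C) (a : hom X A) (b : hom X B), a ;; f = b ;; g ->
    exists! u : hom X P, u ;; pA = a /\ u ;; pB = b.

(* The structure map [r : P -> M] is part of the cone so that the case n = 0,
   where P is M up to isomorphism, is also meaningful. *)
Definition is_wide_pullback (C : category) (E M : C) (q : hom E M) (n : nat)
    (P : C) (r : hom P M) (pi : 'I_n -> hom P E) : Prop :=
  (forall i, pi i ;; q = r) /\
  forall (X : C) (b : hom X M) (h : 'I_n -> hom X E),
    (forall i, h i ;; q = b) ->
    exists! u : hom X P, u ;; r = b /\ forall i, u ;; pi i = h i.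

Record powers (C : category) (E M : C) (q : hom E M) := Powers {
  pw : nat -> C;
  pw_base : forall n, hom (pw n) M;
  pw_proj : forall n, 'I_n -> hom (pw n) E;
  pw_univ : forall n, is_wide_pullback q (pw_base n) (pw_proj (n:=n))
}.
Arguments pw_base {_ _ _ _} _ _.
Arguments pw_proj {_ _ _ _} _ _ _.

Notation pi_ W n i := (pw_proj W n (@Ordinal n i isT)).

Section PowersTheory.
Variables (C : category) (E M : C) (q : hom E M) (W : powers q).

Lemma pw_projq n i : pw_proj W n i ;; q = pw_base W n.
Proof. by have [-> _] := pw_univ W n. Qed.

Lemma pw_projE n i j : pw_proj W n i ;; q = pw_proj W n j ;; q.
Proof. by rewrite !pw_projq. Qed.

Definition induced n X (b : hom X M) (h : 'I_n -> hom X E)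
    (hb : forall i, h i ;; q = b) : hom X (pw W n) :=
  proj1_sig (constructive_indefinite_description _ ((pw_univ W n).2 X b h hb)).

Lemma induced_base n X b h hb :
  @induced n X b h hb ;; pw_base W n = b.
Proof.
by have [[e _] _] := proj2_sig (constructive_indefinite_description _
  ((pw_univ W n).2 X b h hb)).
Qed.

Lemma induced_proj n X b h hb i : @induced n X b h hb ;; pw_proj W n i = h i.
Proof.
have [[_ e] _] := proj2_sig (constructive_indefinite_description _
  ((pw_univ W n).2 X b h hb)).
exact: e.
Qed.

Lemma pw_eq n X (u v : hom X (pw W n)) :
  u ;; pw_base W n = v ;; pw_base W n ->
  (forall i, u ;; pw_proj W n i = v ;; pw_proj W n i) -> u = v.
Proof.
move=> eb ep; have [|w [_ wuniq]] :=
  (pw_univ W n).2 X (u ;; pw_base W n) (fun i => u ;; pw_proj W n i).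
  by move=> i; rewrite -compA pw_projq.
transitivity w; first by symmetry; apply: wuniq.
by apply: wuniq; split.
Qed.

Definition two X (a b : hom X E) (i : 'I_2) : hom X E :=
  if val i is 0 then a else b.

Lemma two_base X (a b : hom X E) :
  a ;; q = b ;; q -> forall i, two a b i ;; q = a ;; q.
Proof. by move=> e [[|[]]]. Qed.

(* The map <a,b> : X -> E_2. *)
Definition pair X (a b : hom X E) (e : a ;; q = b ;; q) : hom X (pw W 2) :=
  induced (two_base e).

Lemma pair_base X a b e : @pair X a b e ;; pw_base W 2 = a ;; q.
Proof. exact: induced_base. Qed.

Lemma pair0 X a b e : @pair X a b e ;; pi_ W 2 0 = a.
Proof. exact: induced_proj. Qed.

Lemma pair1 X a b e : @pair X a b e ;; pi_ W 2 1 = b.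
Proof. exact: induced_proj. Qed.

Lemma pair_eq X (u v : hom X (pw W 2)) :
  u ;; pi_ W 2 0 = v ;; pi_ W 2 0 -> u ;; pi_ W 2 1 = v ;; pi_ W 2 1 -> u = v.
Proof.
move=> e0 e1; apply: pw_eq.
  by rewrite -(pw_projq (Ordinal (isT : 0 < 2))) !compA e0.
case=> [[|[|//]] lt_i2].
  by rewrite (_ : Ordinal lt_i2 = Ordinal (isT : 0 < 2)) //; apply: val_inj.
by rewrite (_ : Ordinal lt_i2 = Ordinal (isT : 1 < 2)) //; apply: val_inj.
Qed.

End PowersTheory.

(* The map E_n -> E'_n induced by a commutative square (f1, f0) : q -> q'. *)
Section PowerMap.
Variables (C : category) (E M E' M' : C) (q : hom E M) (q' : hom E' M').
Variables (W : powers q) (W' : powers q') (f1 : hom E E') (f0 : hom M M').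
Hypothesis sq : f1 ;; q' = q ;; f0.

Lemma pwmap_subproof n i :
  pw_proj W n i ;; f1 ;; q' = pw_base W n ;; f0.
Proof. by rewrite -compA sq compA pw_projq. Qed.

Definition pwmap n : hom (pw W n) (pw W' n) :=
  induced W' (pwmap_subproof (n:=n)).

Lemma pwmap_base n : pwmap n ;; pw_base W' n = pw_base W n ;; f0.
Proof. exact: induced_base. Qed.

Lemma pwmap_proj n i : pwmap n ;; pw_proj W' n i = pw_proj W n i ;; f1.
Proof. exact: induced_proj. Qed.
End PowerMap.

(** * Additive bundles *)

Section AdditiveBundle.
Variables (C : category) (E M : C) (q : hom E M).

Section Laws.
Variables (W : powers q) (s : hom (pw W 2) E) (z : hom M E).
Hypotheses (sq : s ;; q = pw_base W 2) (zq : z ;; q = idm M).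

Lemma sumq X (a b : hom X E) (e : a ;; q = b ;; q) :
  pair W e ;; s ;; q = a ;; q.
Proof. by rewrite -compA sq pair_base. Qed.

Lemma addA_subproof_l :
  pair W (pw_projE W (Ordinal (isT : 0 < 3)) (Ordinal (isT : 1 < 3))) ;; s ;; q
  = pi_ W 3 2 ;; q.
Proof. by rewrite sumq; apply: pw_projE. Qed.

Lemma addA_subproof_r :
  pi_ W 3 0 ;; q =
  pair W (pw_projE W (Ordinal (isT : 1 < 3)) (Ordinal (isT : 2 < 3))) ;; s ;; q.
Proof. by rewrite sumq; apply: pw_projE. Qed.

Lemma add0_subproof : q ;; z ;; q = idm E ;; q.
Proof. by rewrite -compA zq compm1 comp1m. Qed.

(* <<pi_0, pi_1> +, pi_2> + = <pi_0, <pi_1, pi_2> +> + : E_3 -> E *)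
Definition add_associative : Prop :=
  pair W addA_subproof_l ;; s = pair W addA_subproof_r ;; s.

(* <pi_1, pi_0> + = + : E_2 -> E *)
Definition add_commutative : Prop :=
  pair W (pw_projE W (Ordinal (isT : 1 < 2)) (Ordinal (isT : 0 < 2))) ;; s = s.

(* <q 0, 1> + = 1 : E -> E *)
Definition add_left_unit : Prop := pair W add0_subproof ;; s = idm E.
End Laws.

Record additive_bundle := AdditiveBundle {
  ab_powers :> powers q;
  ab_add : hom (pw ab_powers 2) E;
  ab_zero : hom M E;
  ab_addq : ab_add ;; q = pw_base ab_powers 2;
  ab_zeroq : ab_zero ;; q = idm M;
  ab_addA : add_associative ab_addq;
  ab_addC : add_commutative ab_add;
  ab_add0 : add_left_unit ab_add ab_zeroq
}.
End AdditiveBundle.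
Arguments additive_bundle {_ _ _} _.
Arguments ab_add {_ _ _ _} _.
Arguments ab_zero {_ _ _ _} _.

Record additive_morphism (C : category) (E M E' M' : C)
    (q : hom E M) (q' : hom E' M') (A : additive_bundle q)
    (A' : additive_bundle q') (f1 : hom E E') (f0 : hom M M') : Prop :=
  AdditiveMorphism {
    am_sq : f1 ;; q' = q ;; f0;
    am_add : ab_add A ;; f1 = pwmap A A' am_sq 2 ;; ab_add A';
    am_zero : ab_zero A ;; f1 = f0 ;; ab_zero A'
  }.

Definition preserves_powers (C D : category) (F : functor C D)
    (E M : C) (q : hom E M) (W : powers q) : Prop :=
  forall n, is_wide_pullback (fmap F q) (fmap F (pw_base W n))
              (fun i : 'I_n => fmap F (pw_proj W n i)).

(* The additive bundle (F(q), F(+), F(0)), with wide pullbacks F(E_n). *)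
Section FunctorBundle.
Variables (C D : category) (F : functor C D) (E M : C) (q : hom E M).
Variables (A : additive_bundle q) (FA : preserves_powers F A).

Definition fpowers : powers (fmap F q) := Powers FA.

Lemma fpairE X (a b : hom X E) (a' b' : hom (F X) (F E)) (e : a ;; q = b ;; q)
    (e' : a' ;; fmap F q = b' ;; fmap F q) :
  a' = fmap F a -> b' = fmap F b -> pair fpowers e' = fmap F (pair A e).
Proof.
move=> ea eb; apply: (@pair_eq _ _ _ _ fpowers).
  by rewrite pair0 ea -[X in fmap F X](pair0 A e) fmapM.
by rewrite pair1 eb -[X in fmap F X](pair1 A e) fmapM.
Qed.

Lemma fadd_subproof :
  fmap F (ab_add A) ;; fmap F q = pw_base fpowers 2.
Proof. by rewrite -fmapM ab_addq. Qed.

Lemma fzero_subproof : fmap F (ab_zero A) ;; fmap F q = idm (F M).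
Proof. by rewrite -fmapM ab_zeroq fmap1. Qed.

Lemma faddA_subproof : @add_associative _ _ _ _ fpowers _ fadd_subproof.
Proof.
have := congr1 (fun u => fmap F u) (ab_addA A); rewrite !fmapM => addA.
rewrite /add_associative; etransitivity; last (etransitivity; first exact: addA).
  congr (_ ;; _); apply: fpairE => //.
  by rewrite fmapM; congr (_ ;; _); apply: fpairE.
congr (_ ;; _); symmetry; apply: fpairE => //.
by rewrite fmapM; congr (_ ;; _); apply: fpairE.
Qed.

Lemma faddC_subproof : @add_commutative _ _ _ _ fpowers (fmap F (ab_add A)).
Proof.
rewrite /add_commutative -[RHS](congr1 (fun u => fmap F u) (ab_addC A)) fmapM.
by congr (_ ;; _); apply: fpairE.
Qed.

Lemma fadd0_subproof :
  @add_left_unit _ _ _ _ fpowers (fmap F (ab_add A)) _ fzero_subproof.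
Proof.
rewrite /add_left_unit -[RHS]fmap1 -[in RHS](ab_add0 A) fmapM.
by congr (_ ;; _); apply: fpairE; rewrite ?fmapM ?fmap1.
Qed.

Definition fbundle : additive_bundle (fmap F q) :=
  @AdditiveBundle _ _ _ _ fpowers _ _ _ _
    faddA_subproof faddC_subproof fadd0_subproof.
End FunctorBundle.

(** * Tangent categories *)

(* The part of a tangent category not involving the lift and the flip: the
   functor T, the projection p, and the additive bundles (p_M, +_M, 0_M), whose
   wide pullbacks are the T_n M. *)
Record pretangent := Pretangent {
  pt_cat :> category;
  T : functor pt_cat pt_cat;
  p : forall M : pt_cat, hom (T M) M;
  p_natural : natural (F := T) (G := fid pt_cat) p;
  tb : forall M : pt_cat, additive_bundle (p M);
  tb_preserved : forall M k, preserves_powers (fpow T k) (tb M)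
}.
Arguments T {_}.
Arguments p {_} _.
Arguments tb {_} _.

Section Pretangent.
Variable C : pretangent.

Lemma p_sq (M N : C) (f : hom M N) : fmap T f ;; p N = p M ;; f.
Proof. by rewrite -(p_natural f). Qed.

Lemma Tn_map1 n (M : C) :
  pwmap (tb M) (tb M) (p_sq (idm M)) n = idm (pw (tb M) n).
Proof.
by apply: pw_eq => [|i]; rewrite ?pwmap_base ?pwmap_proj comp1m ?fmap1 compm1.
Qed.

Lemma Tn_mapM n (M N P : C) (f : hom M N) (g : hom N P) :
  pwmap (tb M) (tb P) (p_sq (f ;; g)) n =
  pwmap (tb M) (tb N) (p_sq f) n ;; pwmap (tb N) (tb P) (p_sq g) n.
Proof.
apply: pw_eq => [|i].
  by rewrite -compA !pwmap_base !compA pwmap_base.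
by rewrite -compA !pwmap_proj !compA pwmap_proj fmapM compA.
Qed.

Definition Tn (n : nat) : functor C C :=
  @Functor C C (fun M => pw (tb M) n) (fun M N f => pwmap _ _ (p_sq f) n)
    (Tn_map1 n) (@Tn_mapM n).

Definition Tbundle (E M : C) (q : hom E M) (A : additive_bundle q)
    (TA : forall k, preserves_powers (fpow T k) A) :
    additive_bundle (fmap T q) :=
  @fbundle _ _ T _ _ _ A (TA 1).

End Pretangent.

Definition zer (C : pretangent) (M : C) : hom M (T M) := ab_zero (tb M).
Definition plus (C : pretangent) (M : C) : hom (Tn C 2 M) (T M) :=
  ab_add (tb M).

(* mu = <pi_0 lambda, pi_1 0> T(+_q) : E_2 -> T(E) *)
Section Mu.
Variables (C : pretangent).
Hypothesis zer_natural : natural (F := fid C) (G := T) (@zer C).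
Variables (E M : C) (q : hom E M) (A : additive_bundle q).
Hypothesis TA : forall k, preserves_powers (fpow T k) A.
Variable lambda : hom E (T E).
Hypothesis lambda_sq : lambda ;; fmap T q = q ;; zer M.

Lemma mu_subproof :
  pi_ A 2 0 ;; lambda ;; fmap T q = pi_ A 2 1 ;; zer E ;; fmap T q.
Proof.
rewrite -!compA lambda_sq (zer_natural q) /= !compA.
by congr (_ ;; _); apply: pw_projE.
Qed.

Definition mu : hom (pw A 2) (T E) :=
  pair (Tbundle TA) mu_subproof ;; fmap T (ab_add A).
End Mu.

Record tangent_category := TangentCategory {
  tc_pre :> pretangent;
  zer_natural : natural (F := fid tc_pre) (G := T) (@zer tc_pre);
  plus_natural : natural (F := Tn tc_pre 2) (G := T) (@plus tc_pre);
  ell : forall M : tc_pre, hom (T M) (T (T M));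
  ell_natural : natural (F := T) (G := fcomp T T) ell;
  flip : forall M : tc_pre, hom (T (T M)) (T (T M));
  flip_natural : natural (F := fcomp T T) (G := fcomp T T) flip;
  ell_additive : forall M : tc_pre,
    additive_morphism (tb M) (Tbundle (tb_preserved M)) (ell M) (zer M);
  flip_additive : forall M : tc_pre,
    additive_morphism (Tbundle (tb_preserved M)) (tb (T M))
      (flip M) (idm (T M));
  flip_flip : forall M, flip M ;; flip M = idm (T (T M));
  ell_flip : forall M, ell M ;; flip M = ell M;
  ell_ell : forall M, ell M ;; ell (T M) = ell M ;; fmap T (ell M);
  flip_braid : forall M,
    fmap T (flip M) ;; flip (T M) ;; fmap T (flip M) =
    flip (T M) ;; fmap T (flip M) ;; flip (T M);
  ell_flip_flip : forall M,
    ell (T M) ;; fmap T (flip M) ;; flip (T M) = flip M ;; fmap T (ell M);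
  ell_universal : forall (M : tc_pre) k,
    let Tk := fpow T k in
    is_pullback (fmap Tk (fmap T (p M))) (fmap Tk (zer M))
      (fmap Tk (mu zer_natural (tb_preserved M) (am_sq (ell_additive M))))
      (fmap Tk (pi_ (tb M) 2 0 ;; p M))
}.
Arguments ell {_} _.
Arguments flip {_} _.

(** * Differential bundles and vertical connections *)

(* Being preserved by T^k includes, for k = 0, being a pullback. *)
Record differential_bundle (C : tangent_category) (E M : C) (q : hom E M) :=
  DifferentialBundle {
    db_bundle :> additive_bundle q;
    lam : hom E (T E);
    db_preserved : forall k, preserves_powers (fpow T k) db_bundle;
    db_pullbacks : forall n m, exists (P : C)
      (u : hom P (pw db_bundle n)) (v : hom P (Tn C m M)),
      forall k, let Tk := fpow T k in
        is_pullback (fmap Tk (pw_base db_bundle n))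
          (fmap Tk (pw_base (tb M) m)) (fmap Tk u) (fmap Tk v);
    lam_additive_T :
      additive_morphism db_bundle (Tbundle db_preserved) lam (zer M);
    lam_additive_p :
      additive_morphism db_bundle (tb E) lam (ab_zero db_bundle);
    lam_universal : forall k, let Tk := fpow T k in
      is_pullback (fmap Tk (fmap T q)) (fmap Tk (zer M))
        (fmap Tk (mu (@zer_natural C) db_preserved (am_sq lam_additive_T)))
        (fmap Tk (pi_ db_bundle 2 0 ;; q));
    lam_ell : lam ;; ell E = lam ;; fmap T lam
  }.
Arguments lam {_ _ _ _} _.

(* [Qf], on [fq : fE -> X], is the pullback of [Q] along [f : X -> M], with
   second projection [fE_E : fE -> E]. That [(fE_E, f)] is additive, together
   with [fq] being the projection of [Qf], says that the addition and the zero
   of [Qf] are the maps induced by those of [Q]. *)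
Record is_pullback_bundle (C : tangent_category) (E M X fE : C)
    (q : hom E M) (Q : differential_bundle q) (f : hom X M)
    (fq : hom fE X) (Qf : differential_bundle fq) (fE_E : hom fE E) : Prop :=
  IsPullbackBundle {
    pb_preserved : forall k, let Tk := fpow T k in
      is_pullback (fmap Tk q) (fmap Tk f) (fmap Tk fE_E) (fmap Tk fq);
    pb_additive : additive_morphism Qf Q fE_E f;
    pb_lam : lam Qf ;; fmap T fE_E = fE_E ;; lam Q;
    pb_lamq : lam Qf ;; fmap T fq = fq ;; zer X
  }.

Record vertical_connection (C : tangent_category) (E M : C) (q : hom E M)
    (Q : differential_bundle q) (K : hom (T E) E) : Prop :=
  VerticalConnection {
    vc_retract : lam Q ;; K = idm E;
    vc_proj : K ;; q = p E ;; q;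
    vc_ell : K ;; lam Q = ell E ;; fmap T K;
    vc_flip : K ;; lam Q = fmap T (lam Q) ;; flip E ;; fmap T K
  }.

(* Main.v *)
From mathcomp Require Import all_boot.
Require Import Defs.

Set Implicit Arguments.
Unset Strict Implicit.
Unset Printing Implicit Defensive.

(** Since [f^*(E)] is a pullback, a map into it is determined by its composites
    with the two projections [fE_E] and [fq]; since that pullback is preserved
    by [T], a map into [T(f^*(E))] is determined by its composites with
    [T(fE_E)] and [T(fq)].  Existence and uniqueness of [f^*(K)] are the
    universal property of the pullback.  Of the equations of a vertical
    connection, [f^*(K) fq = p fq] is the defining equation of [f^*(K)] along
    [fq] with [p] moved across [fq] by naturality; the other three are checked
    on the two projections.

    Along [fE_E], each of these is the corresponding equation for [K], carried
    through the naturality of [ell] and of the flip.  Along [fq], the lift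
    becomes the zero section and [f^*(K)] becomes the projection [p], so what
    remains concerns the tangent bundle of [X] alone: the retraction is
    [0 p = 1], and in each of the other two equations both sides equal
    [T(fq) p 0], by [ell T(p) = p 0] and [c T(p) = p] respectively. *)

Local Open Scope cat_scope.

Lemma pullback_jointly_monic (C : category) (A B D P : C)
    (f : hom A D) (g : hom B D) (pA : hom P A) (pB : hom P B)
    (pb : is_pullback f g pA pB) (X : C) (u v : hom X P) :
  u ;; pA = v ;; pA -> u ;; pB = v ;; pB -> u = v.
Proof.
move=> eA eB; have [sq univ] := pb.
have [|w [_ w_unique]] := univ X (u ;; pA) (u ;; pB).
  by rewrite -!compA sq.
by rewrite -(w_unique u) // -(w_unique v).
Qed.

Section TangentIdentities.
Variables (C : tangent_category) (M : C).

Lemma zer_p : zer M ;; p M = idm M.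
Proof. exact: ab_zeroq. Qed.

Lemma ell_Tp : ell M ;; fmap T (p M) = p M ;; zer M.
Proof. exact: am_sq (ell_additive M). Qed.

(** Additivity of the flip gives [c p = T(p)]; precomposing with the involution
    [c] turns this around. *)
Lemma flip_Tp : flip M ;; fmap T (p M) = p (T M).
Proof.
have flip_p := am_sq (flip_additive M).
by rewrite compm1 in flip_p; rewrite -flip_p compA flip_flip comp1m.
Qed.

End TangentIdentities.

Section PullbackConnection.
Variables (C : tangent_category) (E M : C) (q : hom E M).
Variables (Q : differential_bundle q) (K : hom (T E) E).
Hypothesis hK : vertical_connection Q K.
Variables (X fE : C) (f : hom X M) (fq : hom fE X) (fE_E : hom fE E).
Variables (Qf : differential_bundle fq).
Hypothesis hf : is_pullback_bundle Q f Qf fE_E.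

(** The compatibility that lets the pullback induce [f^*(K)]: since [K] lies
    over [p], both composites are [p fE_E q = p fq f]. *)
Lemma pullback_connection_square :
  fmap T fE_E ;; K ;; q = fmap T fq ;; p X ;; f.
Proof.
have sq : fE_E ;; q = fq ;; f := (pb_preserved hf 0).1.
by rewrite -compA (vc_proj hK) compA !p_sq -!compA sq.
Qed.

Variable fK : hom (T fE) fE.
Hypothesis fK_E : fK ;; fE_E = fmap T fE_E ;; K.
Hypothesis fK_q : fK ;; fq = fmap T fq ;; p X.

Lemma pullback_connection_retract : lam Qf ;; fK = idm fE.
Proof.
apply: (pullback_jointly_monic (pb_preserved hf 0)) => /=.
  by rewrite -compA fK_E compA (pb_lam hf) -compA (vc_retract hK) compm1 comp1m.
by rewrite -compA fK_q compA (pb_lamq hf) -compA zer_p compm1 comp1m.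
Qed.

Lemma pullback_connection_lam_E :
  fK ;; lam Qf ;; fmap T fE_E = fmap T fE_E ;; K ;; lam Q.
Proof. by rewrite -compA (pb_lam hf) compA fK_E. Qed.

Lemma pullback_connection_lam_q :
  fK ;; lam Qf ;; fmap T fq = fmap T fq ;; p X ;; zer X.
Proof. by rewrite -compA (pb_lamq hf) compA fK_q. Qed.

(** Two maps into [T(f^*(E))] are compared, so the pullback used is the image
    under [T] of the one defining [f^*(E)]. *)
Lemma pullback_connection_ell : fK ;; lam Qf = ell fE ;; fmap T fK.
Proof.
apply: (pullback_jointly_monic (pb_preserved hf 1)) => /=.
  rewrite pullback_connection_lam_E -[RHS]compA -fmapM fK_E fmapM.
  by rewrite -compA (vc_ell hK) !compA -(ell_natural fE_E).
rewrite pullback_connection_lam_q -[RHS]compA -fmapM fK_q fmapM.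
by rewrite [RHS]compA (ell_natural fq) -!compA ell_Tp.
Qed.

(** Naturality moves the flip past [T^2] of a projection, where that projection
    meets [T] of the lift of the pullback bundle: this trades that lift for the
    lift on [E] along [fE_E], and for the zero section along [fq]. *)
Lemma pullback_connection_flip :
  fK ;; lam Qf = fmap T (lam Qf) ;; flip fE ;; fmap T fK.
Proof.
apply: (pullback_jointly_monic (pb_preserved hf 1)) => /=.
  rewrite pullback_connection_lam_E -[RHS]compA -fmapM fK_E fmapM.
  rewrite [RHS]compA -(compA (fmap T (lam Qf))) (flip_natural fE_E) /=.
  rewrite [in RHS]compA -fmapM (pb_lam hf) fmapM.
  by rewrite -compA (vc_flip hK) !compA.
rewrite pullback_connection_lam_q -[RHS]compA -fmapM fK_q fmapM.
rewrite [RHS]compA -(compA (fmap T (lam Qf))) (flip_natural fq) /=.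
rewrite [in RHS]compA -fmapM (pb_lamq hf) fmapM.
by rewrite -!compA flip_Tp p_sq.
Qed.

Lemma pullback_connection_vertical : vertical_connection Qf fK.
Proof.
split.
- exact: pullback_connection_retract.
- by rewrite fK_q p_sq.
- exact: pullback_connection_ell.
- exact: pullback_connection_flip.
Qed.

End PullbackConnection.

Theorem proposition3p9 (C : tangent_category)
  (E M : C) (q : hom E M) (Q : differential_bundle q)
  (K : hom (T E) E) (hK : vertical_connection Q K)
  (X fE : C) (f : hom X M) (fq : hom fE X) (fE_E : hom fE E)
  (Qf : differential_bundle fq) (hf : is_pullback_bundle Q f Qf fE_E) :
  exists fK : hom (T fE) fE,
    unique (fun k : hom (T fE) fE =>
      k ;; fE_E = fmap T fE_E ;; K /\ k ;; fq = fmap T fq ;; p X) fK /\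
    vertical_connection Qf fK.
Proof.
have [_ univ] := pb_preserved hf 0.
have [fK [[fK_E fK_q] fK_unique]] :=
  univ _ _ _ (pullback_connection_square hK hf).
exists fK; split; first by split.
exact: (pullback_connection_vertical hK hf).
Qed.
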